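(* Let $S:\mathbb{R}^n\times\mathbb{R}^m\to\mathbb{R}$ be convex-concave and continuously differentiable, with at least one saddle point. Suppose that the gradient $\nabla S=(\nabla_xS,\nabla_yS)$ is absolutely continuous, and that $S(x,y)$ is $\mu$-strongly convex in $x$ and $q$-strongly concave in $y$, with constants $\mu,q>0$. Then the saddle flow dynamics $$\dot x=-\nabla_xS(x,y),\qquad \dot y=+\nabla_yS(x,y)$$ are globally exponentially stable. More precisely, writing $z=(x,y)$, given the (unique) saddle point $z_\star$ of $S$ and any initial point $z(0)$, $$\|z(t)-z_\star\|\le\|z(0)-z_\star\|e^{-ct}$$ holds (for all $t\ge0$) with the rate $c=\min\{\mu,q\}>0$.
   Context: $S$ is convex-concave if $S(\cdot,y)$ is convex for every $y$ and $S(x,\cdot)$ is concave for every $x$. A saddle point of $S$ is a point $(x_\star,y_\star)$ with $S(x_\star,y)\le S(x_\star,y_\star)\le S(x,y_\star)$ for all $x,y$. $\mu$-strongly convex in $x$ means $S(\cdot,y)-\frac{\mu}{2}\|\cdot\|^2$ is convex for every $y$; $q$-strongly concave in $y$ means $S(x,\cdot)+\frac{q}{2}\|\cdot\|^2$ is concave for every $x$. Absolute continuity of $\nabla S$ (a condition weaker than Lipschitz continuity) is understood in the sense that the restriction of $\nabla S$ to line segments is absolutely continuous, so that the fundamental theorem of calculus applies along segments. *)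

(* Defs.v *)
From HB Require Import structures.
From mathcomp Require Import all_boot all_order all_algebra.
From mathcomp Require Import all_classical all_reals all_analysis.

Set Implicit Arguments.
Unset Strict Implicit.
Unset Printing Implicit Defensive.

Import Order.TTheory GRing.Theory Num.Theory.
Import numFieldNormedType.Exports.

Local Open Scope classical_set_scope.
Local Open Scope ring_scope.

(* The library norm `|_| on row vectors and on pairs is the max norm, so the
   Euclidean norm is introduced separately. Topological notions (continuity,
   differentiability, absolute continuity) are the same for both norms. *)
Definition enorm (R : realType) (n : nat) (x : 'rV[R]_n) : R :=
  Num.sqrt (\sum_(i < n) x 0 i ^+ 2).

Definition enorm2 (R : realType) (n m : nat) (z : 'rV[R]_n * 'rV[R]_m) : R :=
  Num.sqrt (\sum_(i < n) z.1 0 i ^+ 2 + \sum_(j < m) z.2 0 j ^+ 2).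

Definition convex (R : realType) (n : nat) (f : 'rV[R]_n -> R) : Prop :=
  convex_function [set: convex_lmodType 'rV[R]_n] f.

Definition concave (R : realType) (n : nat) (f : 'rV[R]_n -> R) : Prop :=
  convex (fun x => - f x).

Definition convex_concave (R : realType) (n m : nat)
    (S : 'rV[R]_n * 'rV[R]_m -> R) : Prop :=
  (forall y, convex (fun x => S (x, y))) /\
  (forall x, concave (fun y => S (x, y))).

Definition strongly_convex_x (R : realType) (n m : nat) (mu : R)
    (S : 'rV[R]_n * 'rV[R]_m -> R) : Prop :=
  forall y, convex (fun x => S (x, y) - mu / 2 * enorm x ^+ 2).

Definition strongly_concave_y (R : realType) (n m : nat) (q : R)
    (S : 'rV[R]_n * 'rV[R]_m -> R) : Prop :=
  forall x, concave (fun y => S (x, y) + q / 2 * enorm y ^+ 2).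

Definition saddle_point (R : realType) (n m : nat)
    (S : 'rV[R]_n * 'rV[R]_m -> R) (zs : 'rV[R]_n * 'rV[R]_m) : Prop :=
  forall x y, S (zs.1, y) <= S zs /\ S zs <= S (x, zs.2).

Definition grad (R : realType) (n : nat) (f : 'rV[R]_n -> R) (x : 'rV[R]_n) :
    'rV[R]_n :=
  \row_(i < n) 'D_(delta_mx 0 i) f x.

Definition grad_x (R : realType) (n m : nat) (S : 'rV[R]_n * 'rV[R]_m -> R)
    (z : 'rV[R]_n * 'rV[R]_m) : 'rV[R]_n :=
  grad (fun x => S (x, z.2)) z.1.

Definition grad_y (R : realType) (n m : nat) (S : 'rV[R]_n * 'rV[R]_m -> R)
    (z : 'rV[R]_n * 'rV[R]_m) : 'rV[R]_m :=
  grad (fun y => S (z.1, y)) z.2.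

Definition gradS (R : realType) (n m : nat) (S : 'rV[R]_n * 'rV[R]_m -> R)
    (z : 'rV[R]_n * 'rV[R]_m) : 'rV[R]_n * 'rV[R]_m :=
  (grad_x S z, grad_y S z).

Definition continuously_differentiable (R : realType) (n m : nat)
    (S : 'rV[R]_n * 'rV[R]_m -> R) : Prop :=
  (forall z, differentiable S z) /\ continuous (gradS S).

Definition absolutely_continuous (R : realType) (V : normedModType R) (a b : R)
    (f : R -> V) : Prop :=
  forall e : R, 0 < e -> exists2 d : R, 0 < d &
    forall (k : nat) (u v : 'I_k -> R),
      (forall i, a <= u i /\ u i <= v i /\ v i <= b) ->
      trivIset [set: 'I_k] (fun i => `]u i, v i[%classic) ->
      \sum_(i < k) (v i - u i) < d ->
      \sum_(i < k) `|f (v i) - f (u i)| < e.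

Definition absolutely_continuous_on_segments (R : realType)
    (V W : normedModType R) (F : V -> W) : Prop :=
  forall z w : V, absolutely_continuous 0 1 (fun s : R => F (z + s *: (w - z))).

Definition saddle_flow (R : realType) (n m : nat)
    (S : 'rV[R]_n * 'rV[R]_m -> R) (z : 'rV[R]_n * 'rV[R]_m) :
    'rV[R]_n * 'rV[R]_m :=
  (- grad_x S z, grad_y S z).

(* Trajectories on [0, +oo[ of z' = F z, with initial point z 0. For continuous F,
   continuity at 0 together with the equation for t > 0 gives the one-sided
   equation at 0. Values of z at negative times play no role. *)
Definition trajectory (R : realType) (V : normedModType R) (F : V -> V)
    (z : R -> V) : Prop :=
  {within `[0, +oo[%classic, continuous z} /\
  (forall t : R, 0 < t -> is_derive t 1 z (F (z t))).

Definition globally_exponentially_stable (R : realType) (n m : nat)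
    (F : 'rV[R]_n * 'rV[R]_m -> 'rV[R]_n * 'rV[R]_m)
    (zs : 'rV[R]_n * 'rV[R]_m) : Prop :=
  F zs = 0 /\
  exists M c : R, [/\ 0 < M, 0 < c &
    forall z, trajectory F z -> forall t : R, 0 <= t ->
      enorm2 (z t - zs) <= M * enorm2 (z 0 - zs) * expR (- (c * t))].

(* Main.v *)
(* Along a trajectory, the squared Euclidean distance V to the saddle point zs
   satisfies V' = 2 <F z, z - zs>. The tangent inequalities of strong convexity
   and concavity, combined with quadratic growth at zs, give V' <= - 2 c V, so
   V(t) e^(2ct) is nonincreasing. *)
Require Import Defs.
From HB Require Import structures.
From mathcomp Require Import all_boot all_order all_algebra.
From mathcomp Require Import all_classical all_reals all_analysis.
From mathcomp Require Import ring lra.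

Set Implicit Arguments.
Unset Strict Implicit.
Unset Printing Implicit Defensive.

Import Order.TTheory GRing.Theory Num.Theory.
Import numFieldNormedType.Exports.

Local Open Scope classical_set_scope.
Local Open Scope ring_scope.

(** * Euclidean inner product on row vectors *)

Definition dot (R : realType) (n : nat) (x y : 'rV[R]_n) : R :=
  \sum_(i < n) x 0 i * y 0 i.

Lemma dotC (R : realType) (n : nat) (x y : 'rV[R]_n) : dot x y = dot y x.
Proof. by apply: eq_bigr => i _; rewrite mulrC. Qed.

Lemma dotDl (R : realType) (n : nat) (x y w : 'rV[R]_n) :
  dot (x + y) w = dot x w + dot y w.
Proof. by rewrite /dot -big_split; apply: eq_bigr => i _; rewrite !mxE mulrDl. Qed.

Lemma dotZl (R : realType) (n : nat) (a : R) (x w : 'rV[R]_n) :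
  dot (a *: x) w = a * dot x w.
Proof. by rewrite /dot mulr_sumr; apply: eq_bigr => i _; rewrite !mxE mulrA. Qed.

Lemma dotDr (R : realType) (n : nat) (x y w : 'rV[R]_n) :
  dot w (x + y) = dot w x + dot w y.
Proof. by rewrite dotC dotDl !(dotC w). Qed.

Lemma dotZr (R : realType) (n : nat) (a : R) (x w : 'rV[R]_n) :
  dot w (a *: x) = a * dot w x.
Proof. by rewrite dotC dotZl dotC. Qed.

Lemma dotNl (R : realType) (n : nat) (x w : 'rV[R]_n) : dot (- x) w = - dot x w.
Proof. by rewrite -scaleN1r dotZl mulN1r. Qed.

Lemma dotNr (R : realType) (n : nat) (x w : 'rV[R]_n) : dot w (- x) = - dot w x.
Proof. by rewrite dotC dotNl dotC. Qed.

Lemma dot_ge0 (R : realType) (n : nat) (x : 'rV[R]_n) : 0 <= dot x x.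
Proof. by apply: sumr_ge0 => i _; rewrite -expr2 sqr_ge0. Qed.

Lemma dot_eq0 (R : realType) (n : nat) (x : 'rV[R]_n) : dot x x = 0 -> x = 0.
Proof.
move=> x0; apply/rowP => i; rewrite mxE; apply/eqP; rewrite -sqrf_eq0 expr2.
apply/eqP; apply: (psumr_eq0P _ x0) => // j _.
by rewrite -expr2 sqr_ge0.
Qed.

Lemma enorm_sqr (R : realType) (n : nat) (x : 'rV[R]_n) :
  enorm x ^+ 2 = dot x x.
Proof.
rewrite sqr_sqrtr; last by apply: sumr_ge0 => i _; exact: sqr_ge0.
by apply: eq_bigr => i _; rewrite expr2.
Qed.

Lemma enorm2E (R : realType) (n m : nat) (z : 'rV[R]_n * 'rV[R]_m) :
  enorm2 z = Num.sqrt (dot z.1 z.1 + dot z.2 z.2).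
Proof. by congr (Num.sqrt (_ + _)); apply: eq_bigr => i _; rewrite expr2. Qed.

(** * Strong convexity: tangent inequality and quadratic growth *)

Definition strongly_convex (R : realType) (n : nat) (k : R)
    (f : 'rV[R]_n -> R) : Prop :=
  convex (fun x => f x - k / 2 * enorm x ^+ 2).

(** Convexity of [f - k/2 |.|^2] along the segment, where the quadratic terms combine by [(1-t)|x|^2
    + t|x+h|^2 - |x+th|^2 = t(1-t)|h|^2]. The point is written [t *: h + x] to match the difference
    quotient of ['D_h f x]. *)
Lemma strongly_convex_segment (R : realType) (n : nat) (k : R)
    (f : 'rV[R]_n -> R) (x h : 'rV[R]_n) (t : R) :
  strongly_convex k f -> 0 <= t -> t <= 1 ->
  f (t *: h + x) <=
    (1 - t) * f x + t * f (x + h) - k / 2 * (t * (1 - t)) * dot h h.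
Proof.
move=> fk t0 t1.
have := fk (Itv01 t0 t1) (x + h) x; rewrite !inE => /(_ I I).
rewrite convRE /= /unstable.onem !enorm_sqr.
have -> : conv (Itv01 t0 t1) (x + h : convex_lmodType _) x = t *: h + x :> 'rV[R]_n.
  rewrite /conv /= /unstable.onem scalerDr scalerBl scale1r.
  by rewrite addrC addrA subrK addrC.
rewrite !dotDl !dotDr !dotZl !dotZr (dotC h x).
move: (dot h h) (dot x x) (dot x h) => hh xx xh.
move: (f (t *: h + x)) (f x) (f (x + h)) => a b c.
lra.
Qed.

Lemma derive_grad (R : realType) (n : nat) (f : 'rV[R]_n -> R)
    (x h : 'rV[R]_n) :
  differentiable f x -> 'D_h f x = dot (grad f x) h.
Proof.
move=> fx; rewrite deriveE // [h in LHS]row_sum_delta linear_sum.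
apply: eq_bigr => i _; rewrite linearZ mxE deriveE // mulrC //.
Qed.

(** Only the limit from the right is kept, since the segment inequality is available for [t] in
    [[0, 1]]. *)
Lemma derive_right_cvg (R : realType) (n : nat) (f : 'rV[R]_n -> R)
    (x h : 'rV[R]_n) :
  differentiable f x ->
  t^-1 * (f (t *: h + x) - f x) @[t --> 0^'+] --> dot (grad f x) h.
Proof.
move=> fx; rewrite -derive_grad //.
apply: cvg_dnbhs_at_right.
exact: (@diff_derivable _ _ _ f x h fx).
Qed.

(** Divide the segment inequality by [t] and let [t] tend to 0 from the right. *)
Lemma strongly_convex_tangent (R : realType) (n : nat) (k : R)
    (f : 'rV[R]_n -> R) (x y : 'rV[R]_n) :
  strongly_convex k f -> differentiable f x ->
  f x + dot (grad f x) (y - x) + k / 2 * dot (y - x) (y - x) <= f y.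
Proof.
move=> fk fx; set h := y - x.
have yE : y = x + h by rewrite /h addrC subrK.
(* After division the bound is [f y - f x - k/2 (1 - t) |h|^2]. Its part linear in [t] is moved to
   the left, so that the right side is constant and the limit compares with a fixed number. *)
have cv : t^-1 * (f (t *: h + x) - f x) - k / 2 * dot h h * t @[t --> 0^'+]
    --> dot (grad f x) h - k / 2 * dot h h * 0.
  apply: cvgB; first exact: derive_right_cvg.
  apply: cvgM; first exact: cvg_cst.
  by apply: cvg_within_filter; exact: cvg_id.
have := cvgr_to_le cv (b := f y - f x - k / 2 * dot h h).
rewrite mulr0 subr0 => H.
suff : dot (grad f x) h <= f y - f x - k / 2 * dot h h by lra.
apply: H; near=> t.
have t0 : 0 < t by [].
have t1 : t <= 1 by near: t; apply: nbhs_right_le.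
have := strongly_convex_segment x h fk (ltW t0) t1; rewrite -yE.
move: (f _) (f x) (f y) (dot h h) => a b c d H1.
rewrite lerBlDr mulrC ler_pdivrMr //; lra.
Unshelve. all: by end_near.
Qed.

(** At a minimizer the difference quotients from the right are nonnegative, so [dot (grad f x) h] is
    nonnegative for every [h]; the choice [h = - grad f x] then forces the gradient to vanish. *)
Lemma grad_minimizer (R : realType) (n : nat) (f : 'rV[R]_n -> R)
    (x : 'rV[R]_n) :
  differentiable f x -> (forall y, f x <= f y) -> grad f x = 0.
Proof.
move=> fx fmin.
have H h : 0 <= dot (grad f x) h.
  have := cvgr_to_ge (derive_right_cvg (h := h) fx) (b := 0); apply; near=> t.
  have t0 : 0 < t by [].
  by rewrite mulr_ge0 ?subr_ge0 // invr_ge0 ltW.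
apply: dot_eq0; apply/eqP; rewrite eq_le H andbT.
by have := H (- grad f x); rewrite dotNr oppr_ge0.
Unshelve. all: by end_near.
Qed.

Lemma strongly_convex_growth (R : realType) (n : nat) (k : R)
    (f : 'rV[R]_n -> R) (x y : 'rV[R]_n) :
  strongly_convex k f -> differentiable f x -> (forall y, f x <= f y) ->
  f x + k / 2 * dot (y - x) (y - x) <= f y.
Proof.
move=> fk fx fmin; have := strongly_convex_tangent y fk fx.
rewrite (grad_minimizer fx fmin) (_ : dot 0 _ = 0) ?addr0 //.
by apply: big1 => i _; rewrite mxE mul0r.
Qed.

Lemma gradN (R : realType) (n : nat) (f : 'rV[R]_n -> R) (x : 'rV[R]_n) :
  differentiable f x -> grad (fun y => - f y) x = - grad f x.
Proof.
move=> fx; apply/rowP => i; rewrite !mxE.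
by rewrite [LHS]deriveN //; exact: diff_derivable.
Qed.

(** Reduces the concave variable to the convex case, so every estimate in [y] comes from applying
    the lemmas above to [-S]. *)
Lemma strongly_convexN (R : realType) (n : nat) (k : R) (f : 'rV[R]_n -> R) :
  concave (fun y => f y + k / 2 * enorm y ^+ 2) ->
  strongly_convex k (fun y => - f y).
Proof.
rewrite /concave /strongly_convex; congr convex.
by apply/funext => y; rewrite opprD.
Qed.

(** * Growth, dissipation and uniqueness at a saddle point *)

Section saddle.
Context (R : realType) (n m : nat) (S : 'rV[R]_n * 'rV[R]_m -> R) (mu q : R)
  (dS : forall z, differentiable S z)
  (S_sc_x : strongly_convex_x mu S) (S_sc_y : strongly_concave_y q S).

Lemma differentiable_partial_x y x : differentiable (fun x => S (x, y)) x.
Proof.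
exact: (@differentiable_comp _ _ _ _ (fun x => (x, y))).
Qed.

Lemma differentiable_partial_y x y : differentiable (fun y => S (x, y)) y.
Proof.
exact: (@differentiable_comp _ _ _ _ (fun y => (x, y))).
Qed.

Lemma saddle_growth_x zs x : saddle_point S zs ->
  S zs + mu / 2 * dot (x - zs.1) (x - zs.1) <= S (x, zs.2).
Proof.
case: zs => xs ys zsP /=.
apply: (strongly_convex_growth (f := fun x => S (x, ys))) => [||u].
- exact: S_sc_x.
- exact: differentiable_partial_x.
- exact: (zsP u ys).2.
Qed.

Lemma saddle_growth_y zs y : saddle_point S zs ->
  S (zs.1, y) <= S zs - q / 2 * dot (y - zs.2) (y - zs.2).
Proof.
case: zs => xs ys zsP /=.
have H := @strongly_convex_growth _ _ q (fun y => - S (xs, y)) ys y.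
rewrite -lerN2 opprB addrC; apply: H.
- exact: strongly_convexN (S_sc_y xs).
- exact: (differentiableN (differentiable_partial_y xs ys)).
- by move=> u; rewrite lerN2; exact: (zsP xs u).1.
Qed.

Lemma saddle_flow_saddle zs : saddle_point S zs -> saddle_flow S zs = 0.
Proof.
case: zs => xs ys zsP; rewrite /saddle_flow /grad_x /grad_y /=.
rewrite (grad_minimizer (differentiable_partial_x ys xs)) => [|u]; last first.
  exact: (zsP u ys).2.
rewrite oppr0; congr pair; apply: oppr_inj; rewrite oppr0.
rewrite -gradN; last exact: differentiable_partial_y.
apply: (grad_minimizer (differentiableN (differentiable_partial_y xs ys))).
by move=> u; rewrite lerN2; exact: (zsP xs u).1.
Qed.

(* The gap S(xs, y) - S(x, ys) produced by the tangent inequalities at (x, y)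
   is itself at most - mu/2 |x - xs|^2 - q/2 |y - ys|^2 by quadratic growth at the saddle point; this doubles the rate. *)
Lemma saddle_flow_dissipative zs z : saddle_point S zs ->
  dot (saddle_flow S z).1 (z.1 - zs.1) + dot (saddle_flow S z).2 (z.2 - zs.2)
  <= - (mu * dot (z.1 - zs.1) (z.1 - zs.1) +
        q * dot (z.2 - zs.2) (z.2 - zs.2)).
Proof.
move=> zsP.
have := saddle_growth_x z.1 zsP; have := saddle_growth_y z.2 zsP.
case: zs z {zsP} => [xs ys] [x y] /=.
rewrite /grad_x /grad_y /=.
have := strongly_convex_tangent xs (S_sc_x y) (differentiable_partial_x y x).
have := strongly_convex_tangent ys (strongly_convexN (S_sc_y x))
  (differentiableN (differentiable_partial_y x y)).
rewrite (gradN (differentiable_partial_y x y)).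
rewrite -(opprB x xs) -(opprB y ys) !(dotNl, dotNr) !opprK.
lra.
Qed.

(** Growth at [zs1] and the saddle inequalities at [zs2] close a cycle: [S zs1 + mu/2 |x2-x1|^2 <= S
    (x2, y1) <= S zs2 <= S (x1, y2) <= S zs1 - q/2 |y2-y1|^2]. Hence both squared distances
    vanish. *)
Lemma saddle_point_unique zs1 zs2 : 0 < mu -> 0 < q ->
  saddle_point S zs1 -> saddle_point S zs2 -> zs1 = zs2.
Proof.
move=> mu0 q0 P1 P2.
have := saddle_growth_x zs2.1 P1; have := saddle_growth_y zs2.2 P1.
have := (P2 zs1.1 zs1.2).1; have := (P2 zs1.1 zs1.2).2.
have := dot_ge0 (zs2.1 - zs1.1); have := dot_ge0 (zs2.2 - zs1.2).
case: zs1 zs2 {P1 P2} => [x1 y1] [x2 y2] /=.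
set dx := dot (x2 - x1) _; set dy := dot (y2 - y1) _ => dy0 dx0 h1 h2 h3 h4.
have [mdx qdy] : mu * dx = 0 /\ q * dy = 0.
  have := mulr_ge0 (ltW mu0) dx0; have := mulr_ge0 (ltW q0) dy0; lra.
congr pair; apply/esym/eqP; rewrite -subr_eq0; apply/eqP; apply: dot_eq0.
  by apply/eqP; move/eqP: mdx; rewrite mulf_eq0 gt_eqF.
by apply/eqP; move/eqP: qdy; rewrite mulf_eq0 gt_eqF.
Qed.

End saddle.

(** * Differentiation along trajectories and exponential decay *)

(** A linear map commutes with difference quotients, and its continuity passes to the limit. It
    serves for the two projections of the pair and for the coordinates of a row vector. *)
Lemma is_derive_linear (R : realType) (V W : normedModType R) (L : V -> W)
    (z : R -> V) (t : R) (dz : V) :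
  linear L -> continuous L -> is_derive t 1 z dz ->
  is_derive t 1 (L \o z) (L dz).
Proof.
move=> linL Lc [zt <-].
have L0 : L 0 = 0 by have := linL (-1) 0 0; rewrite scaler0 addr0 scaleN1r addNr.
have LZB a u v : L (a *: (u - v)) = a *: (L u - L v).
  rewrite -[a *: (u - v)]addr0 linL L0 addr0; congr (_ *: _).
  by rewrite addrC -scaleN1r linL scaleN1r addrC.
have cv : h^-1 *: (((L \o z) \o shift t) (h *: 1) - (L \o z) t) @[h --> 0^']
    --> L ('D_1 z t).
  under eq_cvg do rewrite /= -LZB.
  exact: (cvg_comp _ _ zt (Lc _)).
apply: DeriveDef; first by apply/cvg_ex; exists (L ('D_1 z t)).
exact: cvg_lim cv.
Qed.

Lemma is_derive_dot (R : realType) (n : nat) (z : R -> 'rV[R]_n) (t : R)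
    (dz a : 'rV[R]_n) :
  is_derive t 1 z dz ->
  is_derive t 1 (fun s => dot (z s - a) (z s - a)) (2 * dot dz (z t - a)).
Proof.
move=> zt.
have H (i : 'I_n) : is_derive t 1 (fun s => (z s - a) 0 i * (z s - a) 0 i)
    (2 * (dz 0 i * (z t - a) 0 i)).
  have zi : is_derive t 1 (fun s => (z s - a) 0 i) (dz 0 i).
    have zi := is_derive_linear (L := fun x : 'rV[R]_n => x 0 i) (z := z)
      _ (@coord_continuous _ _ _ 0 i) zt.
    have := @is_deriveB _ _ _ _ _ _ _ _ _ (zi _) (is_derive_cst (a 0 i) t 1).
    rewrite subr0 => H; rewrite (_ : (fun _ => _) =
      ((fun x : 'rV[R]_n => x 0 i) \o z - cst (a 0 i))); first apply: H.
      by move=> c u v; rewrite !mxE.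
    by apply/funext => s; rewrite !mxE.
  apply: is_derive_eq (is_deriveM zi zi) _.
  by rewrite /GRing.scale /=; ring.
have := is_derive_sum H; rewrite -mulr_sumr => {}H.
by rewrite (_ : (fun _ => _) =
  \sum_i (fun s => (z s - a) 0 i * (z s - a) 0 i)) //; apply/funext => s;
  rewrite fct_sumE.
Qed.

Lemma continuous_dot (R : realType) (n : nat) (a : 'rV[R]_n) :
  continuous (fun x : 'rV[R]_n => dot (x - a) (x - a)).
Proof.
move=> x; apply: continuous_big => [|i _]; first exact: add_continuous.
move=> {}x.
have H : {for x, continuous (fun y : 'rV[R]_n => (y - a) 0 i)}.
  rewrite (_ : (fun _ => _) = (fun y : 'rV[R]_n => y 0 i - a 0 i)).
    apply: continuousB; [exact: coord_continuous | exact: cst_continuous].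
  by apply/funext => y; rewrite !mxE.
exact: continuousM.
Qed.

(** A Grönwall argument with integrating factor [expR (2 * c * s)], valid for any field [F]
    satisfying the pointwise dissipation inequality. *)
Lemma trajectory_decay (R : realType) (n m : nat)
    (F : 'rV[R]_n * 'rV[R]_m -> 'rV[R]_n * 'rV[R]_m)
    (zs : 'rV[R]_n * 'rV[R]_m) (c : R) (z : R -> 'rV[R]_n * 'rV[R]_m) (t : R) :
  (forall w, dot (F w).1 (w.1 - zs.1) + dot (F w).2 (w.2 - zs.2)
    <= - c * (dot (w.1 - zs.1) (w.1 - zs.1) + dot (w.2 - zs.2) (w.2 - zs.2))) ->
  trajectory F z -> 0 <= t ->
  enorm2 (z t - zs) <= enorm2 (z 0 - zs) * expR (- (c * t)).
Proof.
move=> Fc [zc zF] t0.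
pose V (w : 'rV[R]_n * 'rV[R]_m) :=
  dot (w.1 - zs.1) (w.1 - zs.1) + dot (w.2 - zs.2) (w.2 - zs.2).
pose E s := V (z s) * expR (2 * c * s).
have V_ge0 w : 0 <= V w by rewrite addr_ge0 ?dot_ge0.
have dE (s : R) : 0 < s -> is_derive s 1 E
    ((2 * (dot (F (z s)).1 ((z s).1 - zs.1) + dot (F (z s)).2 ((z s).2 - zs.2))
      + 2 * c * V (z s)) * expR (2 * c * s)).
  move=> s0.
  have z1 : is_derive s 1 (fst \o z) (F (z s)).1.
    by apply: is_derive_linear (zF s s0) => // w; exact: cvg_fst.
  have z2 : is_derive s 1 (snd \o z) (F (z s)).2.
    by apply: is_derive_linear (zF s s0) => // w; exact: cvg_snd.
  have dV := is_deriveD (is_derive_dot zs.1 z1) (is_derive_dot zs.2 z2).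
  have de : is_derive s 1 (expR \o ( *%R (2 * c))) (expR (2 * c * s) * (2 * c)).
    apply: is_derive1_comp.
    by apply: is_derive_eq; rewrite scaler1.
  apply: is_derive_eq (is_deriveM dV de) _.
  by rewrite /V !fctE /GRing.scale /=; ring.
have Vc : continuous V.
  move=> w; apply: (@continuousD _ _ _
    ((fun x => dot (x - zs.1) (x - zs.1)) \o fst)
    ((fun x => dot (x - zs.2) (x - zs.2)) \o snd)).
    by apply: continuous_comp; [exact: cvg_fst | exact: continuous_dot].
  by apply: continuous_comp; [exact: cvg_snd | exact: continuous_dot].
have expc : continuous (fun s : R => expR (2 * c * s)).
  move=> s; apply: (@continuous_comp _ _ _ ( *%R (2 * c))).
    exact: mulrl_continuous.
  exact: continuous_expR.
(* The differential equation holds only for positive times; continuity up to 0 is what lets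
   monotonicity reach the initial point. *)
have EC : {within `[0, +oo[, continuous E}.
  move=> s; apply: (@continuousM _ (subspace _) (V \o z) (fun s => expR (2 * c * s))).
    by apply: (@continuous_comp (subspace _) _ _ z V s); [exact: zc | exact: Vc].
  exact: continuous_subspaceT.
have E0 : E t <= E 0.
  apply: (ler0_derive1_nincry (a := 0)) => // s; rewrite in_itv /= andbT => s0.
    by have [] := dE s s0.
  (* The derivative of [E] is [2 <F z, z - zs> + 2 c V] times a positive exponential, and
     dissipation makes the first factor nonpositive. *)
  rewrite derive1E; have [_ ->] := dE s s0.
  rewrite mulr_le0_ge0 ?expR_ge0 //.
  by have := Fc (z s); rewrite -/(V _); lra.
rewrite !enorm2E /= -/(V (z t)) -/(V (z 0)).
(* The square root halves the rate [2c] at which the squared distance decays. *)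
have -> : expR (- (c * t)) = Num.sqrt (expR (- (2 * c * t))).
  rewrite (_ : - (2 * c * t) = - (c * t) + - (c * t)); last by ring.
  by rewrite expRD -expr2 sqrtr_sqr ger0_norm ?expR_ge0.
rewrite -sqrtrM // ler_wsqrtr // expRN ler_pdivlMr ?expR_gt0 //.
by move: E0; rewrite /E mulr0 expR0 mulr1.
Qed.

Theorem theorem10 (R : realType) (n m : nat) (S : 'rV[R]_n * 'rV[R]_m -> R)
    (mu q : R) (c := Num.min mu q)
    (S_cc : convex_concave S)
    (S_C1 : continuously_differentiable S)
    (S_saddle : exists zs, saddle_point S zs)
    (gradS_ac : absolutely_continuous_on_segments (gradS S))
    (mu_gt0 : 0 < mu) (q_gt0 : 0 < q)
    (S_sc_x : strongly_convex_x mu S)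
    (S_sc_y : strongly_concave_y q S) :
  (exists! zs, saddle_point S zs) /\
  (forall zs, saddle_point S zs ->
    [/\ globally_exponentially_stable (saddle_flow S) zs,
        0 < c &
        forall z : R -> 'rV[R]_n * 'rV[R]_m, trajectory (saddle_flow S) z ->
          forall t : R, 0 <= t ->
            enorm2 (z t - zs) <= enorm2 (z 0 - zs) * expR (- (c * t))]).
Proof.
have dS := S_C1.1.
split.
  have [zs zsP] := S_saddle; exists zs; split => // zs' zsP'.
  exact: (saddle_point_unique dS S_sc_x S_sc_y mu_gt0 q_gt0).
move=> zs zsP.
have c_gt0 : 0 < c by rewrite lt_min mu_gt0.
have decay z : trajectory (saddle_flow S) z -> forall t, 0 <= t ->
    enorm2 (z t - zs) <= enorm2 (z 0 - zs) * expR (- (c * t)).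
  move=> zF t t0; apply: trajectory_decay zF t0 => w.
  apply: (le_trans (saddle_flow_dissipative dS S_sc_x S_sc_y w zsP)).
  (* Each of [mu] and [q] is at least [c], and the squared distances they multiply are
     nonnegative. *)
  rewrite mulNr lerN2 mulrDr lerD // ler_wpM2r ?dot_ge0 //.
    by rewrite ge_min lexx.
  by rewrite ge_min lexx orbT.
split => //; split; first exact: saddle_flow_saddle.
(* The decay estimate has no overshoot factor, so [M = 1] works. *)
by exists 1, c; split => // z zF t t0; rewrite mul1r; exact: decay.
Qed.
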